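(* Let $\Lambda\in\mathrm{Lin}^{\mathbb{R}}_{\mathcal{RF}}(\mathbb{H})$. One of the following facts is true. 1. $s(\Lambda)=3$. For all $g,h\in\mathbb{S}$, $\Lambda\notin\mathrm{Lin}^{\mathbb{C}}_{gh}(\mathbb{H}_l,\mathbb{H}_r)$. 2. $s(\Lambda)=2$. There exists $\hat g\in\mathbb{S}$, unique up to sign, such that, for $g,h\in\mathbb{S}$, $\Lambda\in\mathrm{Lin}^{\mathbb{C}}_{gh}(\mathbb{H}_l,\mathbb{H}_r)\Longleftrightarrow(g,h)\in\{(\hat g,\hat g),(-\hat g,-\hat g)\}$. When $\hat g$ is completed to any orthogonal basis $(e_1,e_2,\hat g)$ of $\mathrm{Im}(\mathbb{H})$, $\Lambda$ can be represented as $\Lambda=\lambda_1\bar\vartheta_{e_1}+\lambda_2\bar\vartheta_{e_2}$ for some nonzero $\lambda_1,\lambda_2\in\mathbb{H}$. 3. $s(\Lambda)=1$. For all $g\in\mathbb{S}$, there exists a unique $h\in\mathbb{S}$ such that $\Lambda\in\mathrm{Lin}^{\mathbb{C}}_{gh}(\mathbb{H}_l,\mathbb{H}_r)$. Namely, if $\Lambda=\lambda_1\bar\vartheta_{e_1}$ for some $\lambda_1\in\mathbb{H}\setminus\{0\}$, $e_1\in\mathbb{S}$, then $h=\bar\vartheta_{e_1}(g)$ (which equals $g$ if, and only if, $g\perp e_1$). 4. $s(\Lambda)=0$. $\Lambda\equiv0$ is included in $\mathrm{Lin}^{\mathbb{C}}_{gh}(\mathbb{H}_l,\mathbb{H}_r)$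 for all $g,h\in\mathbb{S}$.
   Context: $\mathbb{H}$ is the algebra of real quaternions, with scalar product $\langle x,y\rangle=\mathrm{Re}(x\bar y)$ and norm $|x|$; $\mathrm{Im}(\mathbb{H})$ is the space of quaternions with zero real part; $\mathbb{S}=\{x\in\mathrm{Im}(\mathbb{H}):|x|=1\}$. For $p\in\mathbb{H}\setminus\{0\}$, $\bar\vartheta_p(x):=p\bar xp^{-1}$; for $\lambda\in\mathbb{H}$, $\lambda\bar\vartheta_p$ denotes $x\mapsto\lambda\bar\vartheta_p(x)$. $\mathrm{Lin}^{\mathbb{R}}(\mathbb{H})$ is the space of real linear maps $\mathbb{H}\to\mathbb{H}$. For $g,h\in\mathbb{S}$, $\mathrm{Lin}^{\mathbb{C}}_{gh}(\mathbb{H}_l,\mathbb{H}_r)$ is the set of $\Lambda\in\mathrm{Lin}^{\mathbb{R}}(\mathbb{H})$ with $\Lambda(gx)=\Lambda(x)h$ for all $x\in\mathbb{H}$. $\mathrm{Lin}^{\mathbb{R}}_{\mathcal{RF}}(\mathbb{H})$ is the set of $\Lambda\in\mathrm{Lin}^{\mathbb{R}}(\mathbb{H})$ such that $\sum_{\ell=0}^3\Lambda(e_\ell)e_\ell=0$ for one (equivalently any) orthonormal basis $(e_0,e_1,e_2,e_3)$ of $\mathbb{H}$ with $e_0=1$. Given any orthogonal basis $(e_1,e_2,e_3)$ of $\mathrm{Im}(\mathbb{H})$, each $\Lambda\in\mathrm{Lin}^{\mathbb{R}}_{\mathcal{RF}}(\mathbb{H})$ decomposes uniquely as $\Lambda=\sum_{\ell=1}^3\lambda_\ell\bar\vartheta_{e_\ell}$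 with $\lambda_\ell\in\mathbb{H}$; the size $s(\Lambda)\in\{0,1,2,3\}$ is the minimal number of nonzero $\lambda_\ell$'s over all choices of orthogonal bases $(e_1,e_2,e_3)$ of $\mathrm{Im}(\mathbb{H})$. *)

(* Defs.v *)
From HB Require Import structures.
From mathcomp Require Import all_boot all_order all_algebra.
From mathcomp Require Import boolp reals.
From mathcomp Require Import ring lra.
Set Implicit Arguments.
Unset Strict Implicit.
Unset Printing Implicit Defensive.
Import Order.TTheory GRing.Theory Num.Theory.
Local Open Scope ring_scope.

(* [Quat a b c d] stands for a + b i + c j + d k. *)
Record quat (R : Type) := Quat { qre : R; qi : R; qj : R; qk : R }.

Section QuatAlgebra.
Variable R : realType.
Implicit Types (a b : R) (x y z : quat R).

Lemma quat_ext x y :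
  qre x = qre y -> qi x = qi y -> qj x = qj y -> qk x = qk y -> x = y.
Proof. by case: x => ? ? ? ?; case: y => ? ? ? ? /= -> -> -> ->. Qed.

Definition quat_tuple x : R * R * R * R := (qre x, qi x, qj x, qk x).
Definition tuple_quat (t : R * R * R * R) : quat R :=
  let: (a, b, c, d) := t in Quat a b c d.

Fact quat_tupleK : cancel quat_tuple tuple_quat.
Proof. by case. Qed.

HB.instance Definition _ := Choice.copy (quat R) (can_type quat_tupleK).

Definition addq x y :=
  Quat (qre x + qre y) (qi x + qi y) (qj x + qj y) (qk x + qk y).
Definition oppq x := Quat (- qre x) (- qi x) (- qj x) (- qk x).
Definition zeroq : quat R := Quat 0 0 0 0.

Fact addqA : associative addq.
Proof. by move=> x y z; apply: quat_ext; rewrite /= addrA. Qed.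
Fact addqC : commutative addq.
Proof. by move=> x y; apply: quat_ext; rewrite /= addrC. Qed.
Fact add0q : left_id zeroq addq.
Proof. by move=> x; apply: quat_ext; rewrite /= add0r. Qed.
Fact addNq : left_inverse zeroq oppq addq.
Proof. by move=> x; apply: quat_ext; rewrite /= addNr. Qed.

HB.instance Definition _ :=
  GRing.isZmodule.Build (quat R) addqA addqC add0q addNq.

Definition oneq : quat R := Quat 1 0 0 0.
Definition mulq x y := Quat
  (qre x * qre y - qi x * qi y - qj x * qj y - qk x * qk y)
  (qre x * qi y + qi x * qre y + qj x * qk y - qk x * qj y)
  (qre x * qj y - qi x * qk y + qj x * qre y + qk x * qi y)
  (qre x * qk y + qi x * qj y - qj x * qi y + qk x * qre y).

Fact mulqA : associative mulq.
Proof. by move=> x y z; apply: quat_ext => /=; ring. Qed.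
Fact mul1q : left_id oneq mulq.
Proof. by move=> x; apply: quat_ext => /=; ring. Qed.
Fact mulq1 : right_id oneq mulq.
Proof. by move=> x; apply: quat_ext => /=; ring. Qed.
Fact mulqDl : left_distributive mulq +%R.
Proof. by move=> x y z; apply: quat_ext => /=; ring. Qed.
Fact mulqDr : right_distributive mulq +%R.
Proof. by move=> x y z; apply: quat_ext => /=; ring. Qed.
Fact oneq_neq0 : oneq != 0.
Proof. by apply/eqP=> -[] /eqP; rewrite oner_eq0. Qed.

HB.instance Definition _ := GRing.Zmodule_isNzRing.Build (quat R)
  mulqA mul1q mulq1 mulqDl mulqDr oneq_neq0.

Definition scaleq a x := Quat (a * qre x) (a * qi x) (a * qj x) (a * qk x).

Fact scaleqA a b x : scaleq a (scaleq b x) = scaleq (a * b) x.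
Proof. by apply: quat_ext; rewrite /= mulrA. Qed.
Fact scale1q : left_id 1 scaleq.
Proof. by move=> x; apply: quat_ext; rewrite /= mul1r. Qed.
Fact scaleqDr : right_distributive scaleq +%R.
Proof. by move=> a x y; apply: quat_ext; rewrite /= mulrDr. Qed.
Fact scaleqDl x : {morph scaleq^~ x : a b / a + b}.
Proof. by move=> a b; apply: quat_ext; rewrite /= mulrDl. Qed.

HB.instance Definition _ := GRing.Zmodule_isLmodule.Build R (quat R)
  scaleqA scale1q scaleqDr scaleqDl.

Fact scaleqAl a x y : a *: (x * y) = a *: x * y.
Proof. by apply: quat_ext => /=; ring. Qed.
HB.instance Definition _ := GRing.Lmodule_isLalgebra.Build R (quat R) scaleqAl.

Fact scaleqAr a x y : a *: (x * y) = x * (a *: y).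
Proof. by apply: quat_ext => /=; ring. Qed.
HB.instance Definition _ := GRing.Lalgebra_isAlgebra.Build R (quat R) scaleqAr.

Definition conjq x := Quat (qre x) (- qi x) (- qj x) (- qk x).

Definition dotq x y : R := qre (x * conjq y).
Definition normq x : R := Num.sqrt (dotq x x).

Lemma dotqE x y :
  dotq x y = qre x * qre y + qi x * qi y + qj x * qj y + qk x * qk y.
Proof. by rewrite /dotq /=; ring. Qed.

Lemma dotqq_eq0 x : (dotq x x == 0) = (x == 0).
Proof.
apply/eqP/eqP=> [|->]; last by rewrite dotqE /=; ring.
rewrite dotqE => h; apply: quat_ext => /=; nra.
Qed.

Definition invq x : quat R := (dotq x x)^-1 *: conjq x.

Fact mulVq : {in predC1 0, left_inverse 1 invq *%R}.
Proof.
move=> x; rewrite inE -dotqq_eq0 => x0.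
rewrite /invq -scaleqAl; move: x0; rewrite dotqE => x0.
by apply: quat_ext => /=; field.
Qed.
Fact mulqV : {in predC1 0, right_inverse 1 invq *%R}.
Proof.
move=> x; rewrite inE -dotqq_eq0 => x0.
rewrite /invq -scaleqAr; move: x0; rewrite dotqE => x0.
by apply: quat_ext => /=; field.
Qed.
Fact unitqP x y : y * x = 1 /\ x * y = 1 -> predC1 0 x.
Proof.
case=> + _; rewrite /= => h; apply/eqP=> x0; move: h.
by rewrite x0 mulr0 => /esym/eqP; rewrite oner_eq0.
Qed.
Fact invq_out : {in [predC predC1 0], invq =1 id}.
Proof.
move=> x; rewrite !inE negbK => /eqP ->.
by rewrite /invq; apply: quat_ext => /=; ring.
Qed.

HB.instance Definition _ := GRing.NzRing_hasMulInverse.Build (quat R)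
  mulVq mulqV unitqP invq_out.

Definition quat_rV x : 'rV[R]_4 :=
  \row_(i < 4) [:: qre x; qi x; qj x; qk x]`_i.
Definition rV_quat (v : 'rV[R]_4) : quat R :=
  Quat (v 0 (inord 0)) (v 0 (inord 1)) (v 0 (inord 2)) (v 0 (inord 3)).

Fact quat_rV_linear : linear quat_rV.
Proof.
move=> a x y; apply/rowP=> i; rewrite !mxE.
by case: i => [[|[|[|[|]]]]].
Qed.
Fact quat_rV_bij : bijective quat_rV.
Proof.
exists rV_quat => [x|v]; first by apply: quat_ext; rewrite /= !mxE inordK.
apply/rowP=> i; rewrite !mxE -[in RHS](inord_val i).
by case: i => [[|[|[|[|]]]]].
Qed.
Fact quat_vect_axiom : Vector.axiom 4 (quat R).
Proof. by exists quat_rV; [exact: quat_rV_linear|exact: quat_rV_bij]. Qed.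
HB.instance Definition _ :=
  Lmodule_hasFinDim.Build R (quat R) quat_vect_axiom.

Fact qre_linear : linear (@qre R : quat R -> R^o).
Proof. by []. Qed.
HB.instance Definition _ :=
  GRing.isLinear.Build R (quat R) R^o _ (@qre R) qre_linear.

End QuatAlgebra.

Section Lambda.
Variable R : realType.
Implicit Types (p g h x : quat R) (L : {linear quat R -> quat R}).

Definition ImH : {vspace quat R} := lker (linfun (@qre R : quat R -> R^o)).

Lemma mem_ImH x : (x \in ImH) = (qre x == 0).
Proof. by rewrite memv_ker lfunE. Qed.

Definition inS x : Prop := x \in ImH /\ normq x = 1.

Definition thetabar p x : quat R := p * conjq x * p^-1.

Definition in_LinC g h L : Prop := forall x, L (g * x) = L x * h.

Definition orthogonal_basis (n : nat) (U : {vspace quat R})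
    (e : n.-tuple (quat R)) : Prop :=
  basis_of U e /\ forall i j : 'I_n, i != j -> dotq e`_i e`_j = 0.

Definition orthonormal_basis (n : nat) (U : {vspace quat R})
    (e : n.-tuple (quat R)) : Prop :=
  orthogonal_basis U e /\ forall i : 'I_n, normq e`_i = 1.

Definition in_LinRF L : Prop :=
  exists e : 4.-tuple (quat R),
    [/\ orthonormal_basis fullv e, e`_0 = 1 & \sum_(l < 4) L e`_l * e`_l = 0].

Definition decomposition L (e : 3.-tuple (quat R)) (lam : 'I_3 -> quat R) :=
  forall x, L x = \sum_(l < 3) lam l * thetabar e`_l x.

Definition has_terms L (n : nat) : Prop :=
  exists (e : 3.-tuple (quat R)) (lam : 'I_3 -> quat R),
    [/\ orthogonal_basis ImH e, decomposition L e lam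
      & #|[set l | lam l != 0]| = n].

(* The least n with [has_terms L n]; it is 4 when L has no decomposition, which
   does not happen in Lin_RF. *)
Definition size_of L : nat := find (fun n => `[< has_terms L n >]) (iota 0 4).

Lemma size_ofP L n :
  has_terms L n -> has_terms L (size_of L) /\ (size_of L <= n)%N.
Proof.
move=> Ln; have n4 : (n < 4)%N.
  case: Ln => e [lam [_ _ <-]]; rewrite ltnS.
  by apply: leq_trans (max_card _) _; rewrite card_ord.
pose P := fun m => `[< has_terms L m >].
have hasP : has P (iota 0 4).
  by apply/hasP; exists n; [rewrite mem_iota|exact/asboolP].
split.
  have := nth_find 0%N hasP; rewrite nth_iota ?add0n; first by move/asboolP.
  by rewrite -[X in (_ < X)%N](size_iota 0 4) -has_find.
rewrite leqNgt; apply/negP => /(before_find 0%N).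
by rewrite nth_iota // add0n; move/asboolP: Ln => ->.
Qed.

End Lambda.

(* Main.v *)
Require Import Defs.
From mathcomp Require Import all_boot all_order all_algebra.
From mathcomp Require Import reals.
From mathcomp Require Import ring lra.
Import Order.TTheory GRing.Theory Num.Theory.
Local Open Scope ring_scope.
Set Implicit Arguments.
Unset Strict Implicit.
Unset Printing Implicit Defensive.

(** Everything is read off the linear map [defect L x = L 1 * x - L x], restricted
to the imaginary quaternions.

For an imaginary [e], [thetabar e] is the orthogonal reflection along [e]
([thetabar_reflection]).  In an orthogonal basis [e_1, e_2, e_3] of the imaginary
space, a decomposition [L = \sum_l lam_l * thetabar e_l] therefore forces
[2 * lam_l * e_l = defect L e_l] ([defect_decomposition]); conversely these
coefficients do decompose [L], since regularity, a basis-free trace identity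
([LinRF_trace]), says that they add up to [L 1] ([LinRF_decomposition]).  So a
coefficient vanishes exactly when its basis vector lies in the kernel of the
defect, and the size is at most 3 minus the number of orthogonal vectors that can
be found in that kernel ([size_le_kernel]).

It remains to compare this kernel with complex linearity for unit imaginary [g]
and [h].
- [L (g * x) = L x * g] for all [x] holds if and only if [defect L g = 0]
  ([in_LinC_defect], [defect_in_LinC]): if the defect kills [g], then [L] is a
  combination of two reflections that fix [g] and reverse products.
- [L (g * x) = L x * h] with [h != g] makes [L] a single term
  [L 1 * thetabar (g - h)] ([in_LinC_neq]), hence of size at most 1.

In size 3 the kernel is zero and nothing is possible; in size 2 it is a line,
spanned by a unit vector unique up to sign; in size 1 the map is one term, and a
reversed product gives [h = thetabar e_1 g], unique because [L 1] is invertible. *)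

(** * Reflections and orthogonal frames in the quaternions *)

Section Quaternions.
Variable R : realType.
Implicit Types (p g h x y a e : quat R).

Lemma unitq x : (x \is a GRing.unit) = (x != 0).
Proof. by []. Qed.

Lemma invqE x : x^-1 = (dotq x x)^-1 *: conjq x.
Proof. by []. Qed.

Lemma mulqI x y y' : x != 0 -> x * y = x * y' -> y = y'.
Proof. by rewrite -unitq => ux; apply: mulrI. Qed.

Lemma mulqIr x y y' : x != 0 -> y * x = y' * x -> y = y'.
Proof. by rewrite -unitq => ux; apply: mulIr. Qed.

Lemma dotqC x y : dotq x y = dotq y x.
Proof. by rewrite !dotqE; ring. Qed.

Lemma dotqBl x x' y : dotq (x - x') y = dotq x y - dotq x' y.
Proof. by rewrite !dotqE /=; ring. Qed.

Lemma dotqZl k x y : dotq (k *: x) y = k * dotq x y.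
Proof. by rewrite !dotqE /=; ring. Qed.

Lemma dotq_suml (I : finType) (F : I -> quat R) y :
  dotq (\sum_i F i) y = \sum_i dotq (F i) y.
Proof. by rewrite /dotq mulr_suml linear_sum. Qed.

Lemma dotqq_ge0 x : 0 <= dotq x x.
Proof. by rewrite dotqE -!expr2 !addr_ge0 // sqr_ge0. Qed.

(** Unfolding the sphere to two polynomial equations keeps square roots out of
every later computation. *)
Lemma inSE x : inS x <-> qre x = 0 /\ dotq x x = 1.
Proof.
rewrite /inS mem_ImH; split=> -[/eqP x0 n1]; split=> //.
  by have := sqr_sqrtr (dotqq_ge0 x); rewrite -/(Defs.normq x) n1 expr1n.
by rewrite /Defs.normq n1 sqrtr1.
Qed.

Lemma inS_neq0 x : inS x -> x != 0.
Proof. by rewrite inSE -dotqq_eq0 => -[_ ->]; exact: oner_neq0. Qed.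

Lemma inS_normalize x : qre x = 0 -> x != 0 -> inS ((Defs.normq x)^-1 *: x).
Proof.
rewrite -dotqq_eq0 => x0 nz; apply/inSE; split; first by rewrite /= x0 mulr0.
have x2 := dotqq_ge0 x.
rewrite dotqZl dotqC dotqZl mulrA -expr2 exprVn sqr_sqrtr //.
by rewrite mulVf.
Qed.

(** Conjugation reverses products and [y |-> p * y * p^-1] preserves them.  This is
the link with complex linearity: a single term [lam * thetabar p x] turns left
multiplication of [x] by [g] into right multiplication by [thetabar p g]. *)
Lemma thetabarM p x y : p != 0 -> thetabar p (x * y) = thetabar p y * thetabar p x.
Proof.
move=> p0; have -> : thetabar p (x * y) = p * (conjq y * conjq x) * p^-1.
  by congr (_ * _ * _); apply: quat_ext => /=; ring.
by rewrite /thetabar !mulrA mulrVK ?unitq.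
Qed.

Lemma thetabarD p x y : thetabar p (x + y) = thetabar p x + thetabar p y.
Proof.
rewrite /thetabar -mulrDl -mulrDr; congr (_ * _ * _).
by apply: quat_ext => /=; ring.
Qed.

Lemma thetabarZ p k x : thetabar p (k *: x) = k *: thetabar p x.
Proof.
rewrite /thetabar scalerAl scalerAr; congr (_ * _ * _).
by apply: quat_ext => /=; ring.
Qed.

Lemma thetabar1 p : p != 0 -> thetabar p 1 = 1.
Proof.
move=> p0; rewrite /thetabar (_ : conjq 1 = 1) ?mulr1 ?mulrV ?unitq //.
by apply: quat_ext => //=; rewrite oppr0.
Qed.

(** For imaginary [p], [thetabar p] is the orthogonal reflection of the
four-dimensional space in the hyperplane [p^\perp]; in particular it fixes the
real axis and every imaginary quaternion orthogonal to [p]. *)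
Lemma thetabar_reflection p x : qre p = 0 -> p != 0 ->
  thetabar p x = x - (2 * (dotq x p / dotq p p)) *: p.
Proof.
rewrite -dotqq_eq0 /thetabar invqE -scalerAr => p0.
rewrite !dotqE => nz; apply: quat_ext => /=; move: nz; rewrite p0 => nz; field.
all: by move: nz; rewrite !mul0r !add0r.
Qed.

Lemma thetabar_fix p x : qre p = 0 -> p != 0 -> dotq x p = 0 -> thetabar p x = x.
Proof. by move=> p0 nz xp; rewrite thetabar_reflection // xp mul0r mulr0 scale0r subr0. Qed.

Lemma inS_thetabar p g : qre p = 0 -> p != 0 -> inS g -> inS (thetabar p g).
Proof.
move=> p0 nz /inSE [g0 g1]; apply/inSE; rewrite thetabar_reflection //.
split; first by rewrite /= p0 g0 mulr0 subr0.
have pp : dotq p p != 0 by rewrite dotqq_eq0.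
rewrite dotqBl dotqZl ![dotq _ (_ - _)]dotqC !dotqBl !dotqZl g1 (dotqC p g).
by field.
Qed.

Lemma orthogonal_expand (n : nat) (U : {vspace quat R}) (e : n.-tuple (quat R)) x :
  orthogonal_basis U e -> x \in U ->
  x = \sum_(l < n) (dotq x e`_l / dotq e`_l e`_l) *: e`_l.
Proof.
case=> eU eo xU; rewrite {1}(coord_basis eU xU); apply: eq_bigr => l _.
congr (_ *: _); rewrite {2}(coord_basis eU xU) dotq_suml (bigD1 l) //= big1.
  rewrite addr0 dotqZl mulfK // dotqq_eq0.
  by apply: (basis_not0 eU); rewrite mem_nth // size_tuple.
by move=> j jl; rewrite dotqZl eo // mulr0.
Qed.

Lemma orthogonal_basis_card (n : nat) (U : {vspace quat R}) (e : n.-tuple (quat R)) :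
  (forall i : 'I_n, e`_i \in U) -> (forall i : 'I_n, e`_i != 0) ->
  (forall i j : 'I_n, i != j -> dotq e`_i e`_j = 0) -> (\dim U <= n)%N ->
  orthogonal_basis U e.
Proof.
move=> eU e0 eo dU; split=> //; rewrite basisEfree size_tuple dU andbT.
apply/andP; split; last first.
  apply/span_subvP => x /(nthP 0) [i]; rewrite size_tuple => li <-.
  exact: (eU (Ordinal li)).
apply/freeP => k ke0 i; apply/eqP.
have := congr1 (fun x => dotq x e`_i) ke0.
rewrite dotq_suml (bigD1 i) //= big1 => [|j ji]; last by rewrite dotqZl eo ?mulr0.
rewrite addr0 dotqZl [RHS]/dotq mul0r => /eqP.
by rewrite mulf_eq0 dotqq_eq0 (negPf (e0 i)) orbF.
Qed.

Lemma dim_ImH : \dim (ImH R) = 3%N.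
Proof.
have := limg_ker_dim (linfun (@qre R : quat R -> R^o)) fullv.
rewrite capfv dimvf -/(ImH R).
have -> : limg (linfun (@qre R : quat R -> R^o)) = fullv.
  apply/vspaceP => r; rewrite memvf.
  have -> : r = linfun (@qre R : quat R -> R^o) (Quat r 0 0 0) by rewrite lfunE.
  exact: memv_img (memvf _).
by rewrite !dimvf /dim /= => /eqP; rewrite -[X in _ == X]/(3 + 1)%N eqn_add2r => /eqP.
Qed.

Section OrthogonalBasisIm.
Variable e : 3.-tuple (quat R).
Hypothesis eb : orthogonal_basis (ImH R) e.

Lemma basis_Im_re (l : 'I_3) : qre e`_l = 0.
Proof. by apply/eqP; rewrite -mem_ImH; apply: (basis_mem eb.1); rewrite mem_nth // size_tuple. Qed.

Lemma basis_Im_neq0 (l : 'I_3) : e`_l != 0.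
Proof. by apply: (basis_not0 eb.1); rewrite mem_nth // size_tuple. Qed.

(** An orthogonal basis of the imaginary space expands every quaternion once the
real part is split off. *)
Lemma expand_re_Im x :
  x = qre x *: 1 + \sum_(l < 3) (dotq x e`_l / dotq e`_l e`_l) *: e`_l.
Proof.
have yI : x - qre x *: 1 \in ImH R by rewrite mem_ImH /= mulr1 subrr.
rewrite -[LHS](subrK (qre x *: 1)) addrC; congr (_ + _).
rewrite {1}(orthogonal_expand eb yI); apply: eq_bigr => l _; congr (_ / _ *: _).
by rewrite dotqBl dotqZl [X in _ - _ * X]dotqE /= basis_Im_re; ring.
Qed.
End OrthogonalBasisIm.

(** Two orthogonal imaginary quaternions span a quaternionic frame together with
their product.  No normalisation is needed, which allows frames starting at a
difference [g - h] of two unit vectors. *)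
Lemma frame_basis g a : qre g = 0 -> g != 0 -> qre a = 0 -> a != 0 ->
  dotq g a = 0 -> orthogonal_basis (ImH R) [tuple g; a; g * a].
Proof.
move=> gI g0 aI a0 ga.
have gaI : qre (g * a) = 0 by move: ga; rewrite dotqE /= gI aI; lra.
have ga0 : g * a != 0.
  by rewrite -unitq unitrMl ?unitq.
have g_ga : dotq g (g * a) = 0 by rewrite dotqE /= gI aI; ring.
have a_ga : dotq a (g * a) = 0 by rewrite dotqE /= gI aI; ring.
apply: orthogonal_basis_card; last by rewrite dim_ImH.
- by case=> [[|[|[|//]]] ?] /=; rewrite mem_ImH ?gI ?aI ?gaI.
- by case=> [[|[|[|//]]] ?].
by case=> [[|[|[|//]]] ?] [[|[|[|//]]] ?] //= _; rewrite // dotqC.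
Qed.

Lemma exists_orthogonal_Im g : qre g = 0 ->
  exists a, [/\ qre a = 0, a != 0 & dotq g a = 0].
Proof.
move=> gI; case: (eqVneq (Quat 0 (- qj g) (qi g) 0) 0) => [|nz]; last first.
  by exists (Quat 0 (- qj g) (qi g) 0); split=> //; rewrite dotqE /=; ring.
(* Here [g] is a multiple of [k]. *)
case=> gj gi; exists (Quat 0 1 0 0); split=> //.
  by rewrite -dotqq_eq0 dotqE /= !mul0r mul1r !addr0 add0r oner_eq0.
by rewrite dotqE /= gi; ring.
Qed.

Lemma anticomm_Im x y : qre x = 0 -> qre y = 0 -> dotq x y = 0 -> x * y = - (y * x).
Proof.
by rewrite dotqE => x0 y0 xy; apply: quat_ext => /=; move: xy; rewrite x0 y0; lra.
Qed.

Lemma sqr_inS g : inS g -> g * g = - 1.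
Proof.
case/inSE=> g0; rewrite dotqE => g1; apply: quat_ext => /=; move: g1; rewrite g0; lra.
Qed.

Lemma conjq_Im x : qre x = 0 -> conjq x = - x.
Proof. by move=> x0; apply: quat_ext; rewrite /= ?x0 ?oppr0. Qed.

Lemma inv_Im x : qre x = 0 -> x^-1 = - (dotq x x)^-1 *: x.
Proof. by move=> x0; rewrite invqE; apply: quat_ext => /=; rewrite ?x0; ring. Qed.

Lemma inv_inS g : inS g -> g^-1 = - g.
Proof. by case/inSE=> g0 g1; rewrite inv_Im // g1 invr1 scaleN1r. Qed.

End Quaternions.

(** * The defect of a regular map *)

Section RegularMaps.
Variables (R : realType) (L : {linear quat R -> quat R}).
Implicit Types (p g h x y a : quat R).

(** The left-hand side is the contraction of [(x, y) |-> L x * y] against the scalar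
product, so it does not depend on the system used to compute it: expand each
[f k] in the [e l], exchange the sums, and recognise the expansion of [e l] in
the [f k].  The weights accommodate systems that are not normalised. *)
Lemma trace_expansion (m n : nat) (e : 'I_m -> quat R) (f : 'I_n -> quat R)
    (u : 'I_m -> R) (v : 'I_n -> R) :
  (forall x, x = \sum_l (u l * dotq x (e l)) *: e l) ->
  (forall x, x = \sum_l (v l * dotq x (f l)) *: f l) ->
  \sum_l u l *: (L (e l) * e l) = \sum_l v l *: (L (f l) * f l).
Proof.
move=> ue vf.
under [RHS]eq_bigr => k _.
  rewrite {1}[f k]ue linear_sum mulr_suml scaler_sumr.
  over.
rewrite exchange_big /=; apply: eq_bigr => l _.
rewrite {2}[e l]vf mulr_sumr scaler_sumr; apply: eq_bigr => k _.
rewrite linearZ /= -scalerAr -scalerAl !scalerA dotqC.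
by congr (_ *: _); ring.
Qed.

(** The deviation of [L] from left multiplication by [L 1].  Its kernel in the
imaginary space governs both the size of [L] and the pairs for which [L] is
complex linear. *)
Definition defect x := L 1 * x - L x.

Lemma defectZ k x : defect (k *: x) = k *: defect x.
Proof. by rewrite /defect linearZ /= -scalerAr scalerBr. Qed.

Lemma defectB x y : defect (x - y) = defect x - defect y.
Proof. by rewrite /defect linearB mulrBr /= !opprB addrACA [X in _ + X]addrC addrACA. Qed.

(** Evaluate complex linearity at [1]. *)
Lemma in_LinC_defect g : in_LinC g g L -> defect g = 0.
Proof. by move=> /(_ 1); rewrite mulr1 /defect => ->; rewrite subrr. Qed.

(** The other two terms of the decomposition fix both [1] and [e`_l], so only the
[l]-th one contributes, and it changes the sign of [e`_l]. *)
Lemma defect_decomposition (e : 3.-tuple (quat R)) lam (l : 'I_3) :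
  orthogonal_basis (ImH R) e -> decomposition L e lam ->
  defect e`_l = 2 *: (lam l * e`_l).
Proof.
move=> eb dec.
rewrite /defect !dec mulr_suml -sumrB (bigD1 l) //= big1 => [|k kl].
  rewrite thetabar1 ?(basis_Im_neq0 eb) // addr0 mulr1 thetabar_reflection.
  - rewrite divff ?dotqq_eq0 ?(basis_Im_neq0 eb) // mulr1 mulrBr opprB.
    by rewrite addrC subrK -scalerAr.
  - exact: (basis_Im_re eb).
  exact: (basis_Im_neq0 eb).
rewrite thetabar1 ?(basis_Im_neq0 eb) // mulr1 thetabar_fix ?subrr //.
- exact: (basis_Im_re eb).
- exact: (basis_Im_neq0 eb).
by apply: eb.2; rewrite eq_sym.
Qed.

Lemma in_LinC_term lam p g : p != 0 -> (forall x, L x = lam * thetabar p x) ->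
  in_LinC g (thetabar p g) L.
Proof. by move=> p0 Lp x; rewrite !Lp thetabarM // mulrA. Qed.

Hypothesis hL : in_LinRF L.

(** The regularity condition is stated in one orthonormal basis; transported to
[1, e_1, e_2, e_3] by [trace_expansion] it expresses [L 1], because the inverse
of an imaginary [e] is [- e / |e|^2]. *)
Lemma LinRF_trace (e : 3.-tuple (quat R)) : orthogonal_basis (ImH R) e ->
  L 1 = \sum_(l < 3) L e`_l * (e`_l)^-1.
Proof.
move=> eb; case: hL => f [[fb fn] f0 tr].
pose e' (l : 'I_4) := (1 :: e)`_l.
have ex' x : x = \sum_(l < 4) ((dotq (e' l) (e' l))^-1 * dotq x (e' l)) *: e' l.
  rewrite big_ord_recl {1}(expand_re_Im eb x); congr (_ + _).
    by rewrite /e' /= !dotqE /=; congr (_ *: _); field.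
  by apply: eq_bigr => l _; rewrite /e' /= mulrC.
have exf x : x = \sum_(l < 4) (1 * dotq x f`_l) *: f`_l.
  rewrite {1}(orthogonal_expand fb (memvf x)); apply: eq_bigr => l _.
  have fl : dotq f`_l f`_l = 1.
    have := fn l; rewrite /Defs.normq -[RHS](sqrtr1 R) => /eqP.
    rewrite eqr_sqrt ?ler01 //; first by move/eqP.
    exact: dotqq_ge0.
  by rewrite fl divr1 mul1r.
have := trace_expansion ex' exf.
under [in RHS]eq_bigr do rewrite scale1r.
rewrite tr big_ord_recl.
have -> : (dotq (e' ord0) (e' ord0))^-1 = 1.
  by rewrite dotqE /=; field.
rewrite scale1r mulr1 => /eqP; rewrite addr_eq0 => /eqP ->.
rewrite -sumrN; apply: eq_bigr => l _; rewrite /e' lift0 [nth _ (_ :: _) _]/=.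
by rewrite (inv_Im (basis_Im_re eb l)) scaleNr mulrN -scalerAr.
Qed.

(** These are the only possible coefficients, by [defect_decomposition]. *)
Definition defect_coef (e : 3.-tuple (quat R)) (l : 'I_3) :=
  2^-1 *: (defect e`_l * (e`_l)^-1).

(** Writing each [thetabar e_l] as a reflection, the sum becomes
[(\sum_l lam_l) * x - defect x].  The trace identity is exactly what makes the
coefficients add up to [L 1], after which the definition of the defect returns
[L x]. *)
Lemma LinRF_decomposition (e : 3.-tuple (quat R)) :
  orthogonal_basis (ImH R) e -> decomposition L e (defect_coef e).
Proof.
move=> eb.
have sum_coef : \sum_l defect_coef e l = L 1.
  rewrite -scaler_sumr; under eq_bigr.
    move=> l _; rewrite mulrBl mulrK ?unitq ?(basis_Im_neq0 eb) //; over.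
  rewrite sumrB -LinRF_trace // sumr_const card_ord mulrSr addrK.
  by rewrite -scaler_nat scalerA mulVf ?scale1r // pnatr_eq0.
have coefMe l : defect_coef e l * e`_l = 2^-1 *: defect e`_l.
  by rewrite -scalerAl mulrVK // unitq (basis_Im_neq0 eb).
move=> x; under eq_bigr.
  move=> l _; rewrite thetabar_reflection ?(basis_Im_re eb) ?(basis_Im_neq0 eb) //.
  rewrite mulrBr -scalerAr coefMe scalerA mulrAC divff ?pnatr_eq0 // mul1r -defectZ.
  over.
rewrite sumrB -mulr_suml sum_coef.
have defect_sum : defect x = \sum_(l < 3) defect ((dotq x e`_l / dotq e`_l e`_l) *: e`_l).
  rewrite {1}(expand_re_Im eb x) /defect.
  rewrite linearD mulrDr opprD addrACA linearZ /= -scalerAr mulr1 subrr add0r.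
  by rewrite linear_sum mulr_sumr -sumrB.
by rewrite -defect_sum /defect opprB addrC subrK.
Qed.

(** A coefficient vanishes exactly when the defect kills the basis vector, so
minimising the number of terms means choosing a basis with as many vectors as
possible in the kernel of the defect. *)
Lemma has_terms_defect (e : 3.-tuple (quat R)) : orthogonal_basis (ImH R) e ->
  has_terms L #|[set l : 'I_3 | defect e`_l != 0]|.
Proof.
move=> eb; exists e, (defect_coef e); split=> //; first exact: LinRF_decomposition.
apply: eq_card => l; rewrite !inE /defect_coef scaler_eq0 invr_eq0 pnatr_eq0 /=.
congr (~~ _); apply/eqP/eqP => [h|->]; last by rewrite mul0r.
apply: (mulqIr (x := (e`_l)^-1)); last by rewrite h mul0r.
by rewrite invr_eq0 (basis_Im_neq0 eb).
Qed.

Lemma size_le_kernel (e : 3.-tuple (quat R)) (A : {set 'I_3}) :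
  orthogonal_basis (ImH R) e -> (forall l, l \in A -> defect e`_l = 0) ->
  (size_of L <= 3 - #|A|)%N.
Proof.
move=> eb eA; have [_ /leq_trans] := size_ofP (has_terms_defect eb); apply.
have := cardsCs (~: A); rewrite setCK card_ord => <-.
apply/subset_leq_card/subsetP => l; rewrite !inE; apply: contraNN => /eA ->.
by rewrite eqxx.
Qed.

Lemma size_le2 g : qre g = 0 -> g != 0 -> defect g = 0 -> (size_of L <= 2)%N.
Proof.
move=> gI g0 kg; have [a [aI a0 ga]] := exists_orthogonal_Im gI.
have := size_le_kernel (A := [set ord0]) (frame_basis gI g0 aI a0 ga).
by rewrite cards1; apply=> l /set1P ->.
Qed.

Lemma size_le1 g a : qre g = 0 -> g != 0 -> qre a = 0 -> a != 0 ->
  dotq g a = 0 -> defect g = 0 -> defect a = 0 -> (size_of L <= 1)%N.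
Proof.
move=> gI g0 aI a0 ga kg ka.
pose A : {set 'I_3} := [set ord0; lift ord0 ord0].
have := size_le_kernel (A := A) (frame_basis gI g0 aI a0 ga).
by rewrite cards2 /=; apply=> l /set2P [] ->.
Qed.

(** In a frame starting at [g] the coefficient of [thetabar g] is zero, and the
reflections in the two other vectors fix [g] while reversing products. *)
Lemma defect_in_LinC g : inS g -> defect g = 0 -> in_LinC g g L.
Proof.
move=> gS kg; have [gI _] := iffLR (inSE g) gS; have g0 := inS_neq0 gS.
have [a [aI a0 ga]] := exists_orthogonal_Im gI.
have eb := frame_basis gI g0 aI a0 ga.
move=> x; rewrite !(LinRF_decomposition eb) mulr_suml; apply: eq_bigr => l _.
rewrite -mulrA thetabarM ?(basis_Im_neq0 eb) //.
have [->|l0] := eqVneq l ord0; first by rewrite /defect_coef /= kg mul0r scaler0 !mul0r.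
rewrite (thetabar_fix (x := g)) ?(basis_Im_re eb) ?(basis_Im_neq0 eb) //.
by apply: (eb.2 ord0 l); rewrite eq_sym.
Qed.

(** Take a frame [g, a, g * a].  Complex linearity gives [L g = L 1 * h] and
[L (g * a) = L a * h], so that [L] is known once [L 1] and [L a] are; the trace
identity then reads [L a * u = L 1 * u * a] with [u = 1 + h * g].  This [u] is
[h * (g - h)], invertible because [h != g], so [L a] is determined by [L 1].  The
solution is the term with direction [g - h], because the reflection
along [g - h] exchanges the unit vectors [g] and [h]. *)
Lemma in_LinC_neq g h : inS g -> inS h -> h != g -> in_LinC g h L ->
  forall x, L x = L 1 * thetabar (g - h) x.
Proof.
move=> gS hS hg Lgh.
have [gI _] := iffLR (inSE g) gS; have [hI _] := iffLR (inSE h) hS.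
have g0 := inS_neq0 gS.
have [a [aI a0 ga]] := exists_orthogonal_Im gI.
have eb := frame_basis gI g0 aI a0 ga.
set p := g - h.
have p0 : p != 0 by apply: contraNneq hg => /subr0_eq ->.
(* Both forms of [h * p] use that [g] and [h] are square roots of [-1]. *)
have hp : h * p = 1 + h * g by rewrite mulrBr (sqr_inS hS) opprK addrC.
have pg : h * p = - (p * g) by rewrite hp mulrBl (sqr_inS gS) opprB opprK addrC.
have Tg : thetabar p g = h.
  by rewrite /thetabar conjq_Im // mulrN -pg mulrK ?unitq.
have Lg : L g = L 1 * h by rewrite -Lgh mulr1.
have ag : a * g = - (g * a) by apply: anticomm_Im; rewrite // dotqC.
have La : L a = L 1 * thetabar p a.
  (* Multiplying the trace identity by [a] on the right clears the inverses. *)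
  have := LinRF_trace eb; rewrite !big_ord_recl big_ord0 /= addr0 Lgh Lg.
  rewrite invrM ?unitq // (inv_inS gS) => /(congr1 ( *%R^~ a)).
  have aga : a^-1 * (- g * a) = g by rewrite mulNr -ag mulKr ?unitq.
  rewrite !mulrDl mulrVK ?unitq // -!mulrA aga => tr.
  have Ep : L a * (p * g) = L 1 * (p * g) * a.
    move/eqP: tr; rewrite mulNr !mulrN addrC -subr_eq opprK.
    have -> : L 1 * a + L 1 * (h * (g * a)) = L 1 * (1 + h * g) * a.
      by rewrite mulrDr mulrDl mulr1 !mulrA.
    have -> : L a + L a * (h * g) = L a * (1 + h * g) by rewrite mulrDr mulr1.
    by rewrite -hp pg !mulrN mulNr eqr_opp => /eqP.
  apply: (mulqIr p0); apply: (mulqIr g0).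
  rewrite /thetabar conjq_Im // mulrA mulrVK ?unitq // -mulrA Ep.
  by rewrite -!mulrA mulNr ag opprK.
have Lga : L (g * a) = L 1 * thetabar p (g * a) by rewrite Lgh La thetabarM // Tg mulrA.
move=> x; rewrite (expand_re_Im eb x) !big_ord_recl big_ord0 /= addr0.
rewrite !linearD !linearZ /= !(thetabarD, thetabarZ) thetabar1 //.
by rewrite !mulrDr -!scalerAr mulr1 La Lg Lga Tg.
Qed.

(** By [in_LinC_neq] the map is a single reflection followed by a left
multiplication, whose defect vanishes on the plane of imaginary quaternions
orthogonal to [g - h]. *)
Lemma in_LinC_neq_size g h : inS g -> inS h -> h != g -> in_LinC g h L ->
  (size_of L <= 1)%N.
Proof.
move=> gS hS hg Lgh; have Lp := in_LinC_neq gS hS hg Lgh.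
set p := g - h in Lp.
have [gI _] := iffLR (inSE g) gS; have [hI _] := iffLR (inSE h) hS.
have pI : qre p = 0 by rewrite /= gI hI subr0.
have p0 : p != 0 by apply: contraNneq hg => /subr0_eq ->.
have fix_defect x : dotq x p = 0 -> defect x = 0.
  by move=> xp; rewrite /defect [L x]Lp thetabar_fix // subrr.
have [a [aI a0 pa]] := exists_orthogonal_Im pI.
have eb := frame_basis pI p0 aI a0 pa.
apply: (@size_le1 a (p * a)) => //.
- exact: (basis_Im_re eb (lift ord0 (lift ord0 ord0))).
- exact: (basis_Im_neq0 eb (lift ord0 (lift ord0 ord0))).
- exact: (eb.2 (lift ord0 ord0) (lift ord0 (lift ord0 ord0))).
- by apply: fix_defect; rewrite dotqC.
by apply: fix_defect; exact: (eb.2 (lift ord0 (lift ord0 ord0)) ord0).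
Qed.

(** The component of [x] orthogonal to [g] also lies in the kernel of the defect; if
it were nonzero, two orthogonal kernel vectors would force a size of at
most 1. *)
Lemma defect_kernel_line g x : inS g -> inS x -> defect g = 0 -> defect x = 0 ->
  size_of L = 2%N -> x = g \/ x = - g.
Proof.
move=> gS xS kg kx s2.
have [gI g1] := iffLR (inSE g) gS; have [xI x1] := iffLR (inSE x) xS.
pose a := x - dotq x g *: g.
(* When the orthogonal component vanishes, [x] is a unit multiple of [g]. *)
have [a0|a0] := eqVneq a 0; last first.
  suff : (2 <= 1)%N by [].
  rewrite -{1}s2; apply: (@size_le1 g a) => //; first exact: inS_neq0.
  - by rewrite /= gI xI mulr0 subr0.
  - by rewrite dotqC dotqBl dotqZl g1 mulr1 subrr.
  by rewrite defectB defectZ kg kx scaler0 subr0.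
have xE := subr0_eq a0; have /eqP := x1.
rewrite {1}xE dotqZl (dotqC g) -expr2 sqrf_eq1.
by case/orP=> /eqP k1; [left|right]; rewrite xE k1 (scale1r, scaleN1r).
Qed.

Lemma has_terms_size : has_terms L (size_of L).
Proof.
have iI : qre (Quat 0 1 0 0 : quat R) = 0 by [].
have i0 : (Quat 0 1 0 0 : quat R) != 0 by apply: contraTneq isT => -[] /eqP; rewrite oner_eq0.
have [a [aI a0 ia]] := exists_orthogonal_Im iI.
by case: (size_ofP (has_terms_defect (frame_basis iI i0 aI a0 ia))).
Qed.

Lemma size_le3 : (size_of L <= 3)%N.
Proof.
case: has_terms_size => e [lam [_ _ <-]].
by apply: leq_trans (max_card _) _; rewrite card_ord.
Qed.

Lemma size3_notin_LinC : size_of L = 3%N ->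
  forall g h, inS g -> inS h -> ~ in_LinC g h L.
Proof.
move=> s3 g h gS hS Lgh.
have [hg|hg] := eqVneq h g; last first.
  by have := in_LinC_neq_size gS hS hg Lgh; rewrite s3.
have [gI _] := iffLR (inSE g) gS.
suff : (3 <= 2)%N by [].
rewrite -{1}s3; apply: (size_le2 gI (inS_neq0 gS)).
by apply: in_LinC_defect; rewrite -{2}hg.
Qed.

Lemma size0_eq0 : size_of L = 0%N -> forall x, L x = 0.
Proof.
move=> s0 x; case: has_terms_size => e [lam [_ dec]].
rewrite s0 => /eqP; rewrite cards_eq0 => /eqP lam0.
rewrite dec big1 // => l _; have := in_set0 l.
by rewrite -lam0 inE => /negbFE/eqP ->; rewrite mul0r.
Qed.

Lemma size1_term : size_of L = 1%N -> exists lam p,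
  [/\ lam != 0, qre p = 0, p != 0 & forall x, L x = lam * thetabar p x].
Proof.
move=> s1; case: has_terms_size => e [lam [eb dec]].
rewrite s1 => /eqP/cards1P [l El]; exists (lam l), e`_l; split.
- by have := set11 l; rewrite -El inE.
- exact: basis_Im_re.
- exact: basis_Im_neq0.
move=> x; rewrite dec (bigD1 l) //= big1 ?addr0 // => k kl.
have := in_set1 k l; rewrite -El inE (negPf kl) => /negbFE/eqP ->.
by rewrite mul0r.
Qed.

Lemma size2_kernel : size_of L = 2%N -> exists g, inS g /\ defect g = 0.
Proof.
move=> s2; case: has_terms_size => e [lam [eb dec]].
rewrite s2 => c2.
have /card_gt0P [l] : (0 < #|~: [set l | lam l != 0%R]|)%N.
  have := cardsCs [set l | lam l != 0]; rewrite c2 card_ord.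
  by case: #|_|.
rewrite !inE negbK => /eqP l0.
have kl : defect e`_l = 0 by rewrite (defect_decomposition l eb dec) l0 mul0r scaler0.
exists ((Defs.normq e`_l)^-1 *: e`_l); split.
  by apply: inS_normalize; [exact: basis_Im_re|exact: basis_Im_neq0].
by rewrite defectZ kl scaler0.
Qed.

Lemma size2_coef_neq0 (e : 3.-tuple (quat R)) (l : 'I_3) : orthogonal_basis (ImH R) e ->
  size_of L = 2%N -> defect e`_(@ord_max 2) = 0 -> l != ord_max -> defect_coef e l != 0.
Proof.
move=> eb s2 kmax lm; apply/eqP => cl.
have := defect_decomposition l eb (LinRF_decomposition eb).
rewrite cl mul0r scaler0 => kl.
suff : (2 <= 1)%N by [].
rewrite -{1}s2; apply: (@size_le1 e`_(@ord_max 2) e`_l) => //.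
- exact: (basis_Im_re eb ord_max).
- exact: (basis_Im_neq0 eb ord_max).
- exact: (basis_Im_re eb l).
- exact: (basis_Im_neq0 eb l).
by apply: eb.2; rewrite eq_sym.
Qed.

End RegularMaps.

(** * The classification by size *)

Theorem theorem3p15 (R : realType) (L : {linear quat R -> quat R})
    (hL : in_LinRF L) :
  [\/ size_of L = 3%N /\
      (forall g h : quat R, inS g -> inS h -> ~ in_LinC g h L),
      size_of L = 2%N /\
      (exists g0 : quat R,
        [/\ inS g0,
            forall g h : quat R, inS g -> inS h ->
              (in_LinC g h L <->
               (g, h) = (g0, g0) \/ (g, h) = (- g0, - g0)),
            forall g1 : quat R, inS g1 ->
              (forall g h : quat R, inS g -> inS h ->
                (in_LinC g h L <->
                 (g, h) = (g1, g1) \/ (g, h) = (- g1, - g1))) ->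
              g1 = g0 \/ g1 = - g0
          & forall e1 e2 : quat R,
              orthogonal_basis (ImH R) [tuple e1; e2; g0] ->
              exists lam1 lam2 : quat R,
                [/\ lam1 != 0, lam2 != 0
                  & forall x : quat R,
                      L x = lam1 * thetabar e1 x + lam2 * thetabar e2 x]]),
      size_of L = 1%N /\
      (forall g : quat R, inS g ->
        exists h : quat R,
          [/\ inS h, in_LinC g h L,
              forall h' : quat R, inS h' -> in_LinC g h' L -> h' = h
            & forall lam1 e1 : quat R, lam1 != 0 -> inS e1 ->
                (forall x : quat R, L x = lam1 * thetabar e1 x) ->
                h = thetabar e1 g /\ (h = g <-> dotq g e1 = 0)])
    | size_of L = 0%N /\
      ((forall x : quat R, L x = 0) /\
       (forall g h : quat R, inS g -> inS h -> in_LinC g h L))].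
Proof.
have := size_le3 hL; rewrite leq_eqVlt => /orP [/eqP s3|].
  by constructor 1; split=> //; exact: size3_notin_LinC.
rewrite ltnS leq_eqVlt => /orP [/eqP s2|].
  constructor 2; split=> //; have [g0 [g0S k0]] := size2_kernel hL s2.
  have Lg0 := defect_in_LinC hL g0S k0.
  have only g h : inS g -> inS h -> in_LinC g h L -> h = g /\ (g = g0 \/ g = - g0).
    move=> gS hS Lgh.
    have hg : h = g.
      apply/eqP; apply: contraTT isT => hg.
      by have := in_LinC_neq_size hL gS hS hg Lgh; rewrite s2.
    split=> //; apply: (defect_kernel_line hL) => //.
    by apply: in_LinC_defect; rewrite -{2}hg.
  exists g0; split=> //.
  - move=> g h gS hS; split=> [Lgh|].
      by have [-> [->|->]] := only g h gS hS Lgh; [left|right].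
    case=> -[-> ->] // x.
    by rewrite mulNr linearN /= Lg0 mulrN.
  - move=> g1 g1S /(_ g1 g1 g1S g1S) [_ Lg1].
    by have [] := only g1 g1 g1S g1S (Lg1 (or_introl erefl)).
  move=> e1 e2 eb.
  exists (defect_coef L [tuple e1; e2; g0] ord0),
    (defect_coef L [tuple e1; e2; g0] (lift ord0 ord0)).
  split; [exact: size2_coef_neq0|exact: size2_coef_neq0|move=> x].
  rewrite (LinRF_decomposition hL eb) !big_ord_recl big_ord0 addr0 /=.
  congr (_ + _); rewrite -[RHS]addr0; congr (_ + _).
  by rewrite /defect_coef /= k0 mul0r scaler0 mul0r.
rewrite ltnS leq_eqVlt => /orP [/eqP s1|].
  constructor 3; split=> // g gS.
  have [lam [p [lam0 pI p0 Lp]]] := size1_term hL s1.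
  have Lgh := in_LinC_term g p0 Lp.
  have L1 : L 1 != 0 by rewrite Lp thetabar1 // mulr1.
  have uniq_h h' : in_LinC g h' L -> h' = thetabar p g.
    by move=> Lgh'; apply: (mulqI L1); rewrite -Lgh -Lgh'.
  exists (thetabar p g); split=> //; first exact: inS_thetabar.
    by move=> h' _; exact: uniq_h.
  move=> lam1 e1 lam10 e1S Le1; have [e1I _] := iffLR (inSE e1) e1S.
  have e10 := inS_neq0 e1S.
  rewrite -(uniq_h _ (in_LinC_term g e10 Le1)); split=> //.
  rewrite thetabar_reflection //; split=> [/eqP|->]; last first.
    by rewrite mul0r mulr0 scale0r subr0.
  rewrite -subr_eq0 addrAC subrr add0r oppr_eq0 scaler_eq0 (negPf e10) orbF.
  rewrite !mulf_eq0 invr_eq0 dotqq_eq0 (negPf e10) orbF pnatr_eq0 /=.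
  by move/eqP.
rewrite ltnS leqn0 => /eqP s0; constructor 4; split=> //.
have L0 := size0_eq0 hL s0; split=> // g h _ _ x.
by rewrite !L0 mul0r.
Qed.
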